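(* For all $a,a',b,b',c\in X$ the following relations hold: (1) if $a\sim a'$ and $b\sim b'$ then $a*b\sim a'*b'$; (2) $(a*b)*c\sim a*(b*c)$; (3) $a*0\sim 0*a$; (4) $a*a^{-1}\sim 0\sim a^{-1}*a$.
   Context: Functions on the circle $S^1$ are identified with $2\pi$-periodic functions on $\mathbb{R}$. $X$ is the complex vector space of sequences $a=(a_1,a_2,\dots)$ with $a_i\in L^\infty(S^1)$ (complex-valued) for which there is $l>0$ (depending on $a$) with $\sup_{x\in S^1}|a_i(x)|\le l^i$ for all $i\ge1$ (sup understood as the $L^\infty$-norm); $0\in X$ is the zero sequence. For $a,b\in X$: $a*b=(a_1*b_1,a_2*b_2,\dots)\in X$ and $a^{-1}=(a_1^{-1},a_2^{-1},\dots)\in X$, where $(a_i*b_i)(t)=2a_i(2t)$ for $0<t\le\pi$, $(a_i*b_i)(t)=2b_i(2t-2\pi)$ for $\pi<t\le2\pi$, and $a_i^{-1}(t)=-a_i(2\pi-t)$ for $0<t\le2\pi$ (extended $2\pi$-periodically). Basic iterated integrals: $I_{i_1,\dots,i_k}(a)=\int\cdots\int_{0\le s_1\le\cdots\le s_k\le2\pi}a_{i_k}(s_k)\cdots a_{i_1}(s_1)\,ds_k\cdots ds_1$. The set of universal centers is $\mathcal{U}=\{a\in X: I_{i_1,\dots,i_k}(a)=0\text{ for all } k\ge1 \text{ and all positive integers } i_1,\dots,i_k\}$. The relation $a\sim b$ means $a*b^{-1}\in\mathcal{U}$ (an equivalence relation on $X$). *)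

(* Defs.v *)
From mathcomp Require Import all_boot all_order all_algebra.
From mathcomp Require Import complex.
From mathcomp Require Import all_classical all_reals all_analysis.
From mathcomp Require Import ess_sup_inf.
Set Implicit Arguments.
Unset Strict Implicit.
Unset Printing Implicit Defensive.
Import Order.TTheory GRing.Theory Num.Theory.
Import numFieldNormedType.Exports.
Local Open Scope classical_set_scope.
Local Open Scope ring_scope.
Local Open Scope complex_scope.

(* Functions on the circle are 2pi-periodic functions on the line; elements of
   L^oo are represented by functions, everything below (membership in [X] and
   the integrals) being insensitive to modifications on null sets that keep the
   representative periodic and measurable. A sequence (a_1, a_2, ...) is indexed
   from 0: [a n] stands for a_(n+1). *)

Section Definitions.
Variable R : realType.
Implicit Types (f g : R -> R[i]) (a b : nat -> R -> R[i]).

(* The representative of t modulo 2pi in the interval ]0, 2pi]. *)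
Definition circle_repr (t : R) : R :=
  t - 2 * pi * (Num.ceil (t / (2 * pi)) - 1)%:~R.

(* The 2pi-periodic extension of the restriction of f to ]0, 2pi]. *)
Definition periodize f : R -> R[i] := fun t => f (circle_repr t).

Definition cmeasurable f : Prop :=
  measurable_fun [set: R] (fun t => complex.Re (f t)) /\
  measurable_fun [set: R] (fun t => complex.Im (f t)).

(* For a periodic function the essential supremum over the line is the one over
   the circle. The bound on [a n] is l ^ (n + 1) because of the index shift. *)
Definition X : set (nat -> R -> R[i]) := [set a |
  (forall n, cmeasurable (a n) /\ forall t, a n (t + 2 * pi) = a n t) /\
  exists l : R, 0 < l /\ forall n : nat,
    (ess_sup lebesgue_measure (fun t : R => (Normc.normc (a n t))%:E)
       <= (l ^+ n.+1)%:E)%E].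

Definition zero_path : nat -> R -> R[i] := fun _ _ => 0.

Definition concat a b : nat -> R -> R[i] := fun n =>
  periodize (fun t => if t <= pi then 2 * a n (2 * t)
                      else 2 * b n (2 * t - 2 * pi)).

Definition path_inv a : nat -> R -> R[i] := fun n =>
  periodize (fun t => - a n (2 * pi - t)).

Definition cintegral (D : set R) f : R[i] :=
  (\int[lebesgue_measure]_(t in D) complex.Re (f t))
  +i* (\int[lebesgue_measure]_(t in D) complex.Im (f t)).

(* [iter_int a s [:: i_1; ...; i_k]] integrates a_{i_k}(s_k) ... a_{i_1}(s_1)
   ds_k ... ds_1 over s <= s_1 <= ... <= s_k <= 2pi, the variable s_k being the
   innermost one. *)
Fixpoint iter_int a (s : R) (w : seq nat) : R[i] :=
  if w is i :: w' then
    cintegral `[s, 2 * pi] (fun s1 => iter_int a s1 w' * a i s1)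
  else 1.

Definition basic_iter_int a (w : seq nat) : R[i] := iter_int a 0 w.

Definition universal_centers : set (nat -> R -> R[i]) := [set a |
  X a /\ forall w : seq nat, w != [::] -> basic_iter_int a w = 0].

Definition path_equiv a b : Prop := universal_centers (concat a (path_inv b)).

End Definitions.

Arguments X R : clear implicits.
Arguments zero_path R : clear implicits.

(* Main.v *)
(** The family of iterated integrals of [a], seen as a noncommutative formal
    power series, is multiplicative for concatenation (Chen's identity), and the
    series of [a^-1] is inverse to that of [a]. Hence [a ~ b] holds exactly when
    [a] and [b] have the same iterated integrals, and the four relations become
    identities between power series with constant term 1. Both facts are proved
    by induction on the word for the integrals starting at an arbitrary
    parameter [s], with affine changes of variable. *)

Require Import Defs.
From mathcomp Require Import all_boot all_order all_algebra.
From mathcomp Require Import complex.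
From mathcomp Require Import all_classical all_reals all_analysis.
From mathcomp Require Import measurable_realfun ess_sup_inf ring lra.
Set Implicit Arguments.
Unset Strict Implicit.
Unset Printing Implicit Defensive.
Import Order.TTheory GRing.Theory Num.Theory.
Import numFieldNormedType.Exports.
Local Open Scope classical_set_scope.
Local Open Scope ring_scope.
Local Open Scope complex_scope.

(** * Affine changes of variable for the Lebesgue integral *)

Section AffineSubstitution.
Variables (R : realType) (k c : R).
Hypothesis k0 : k != 0.
Local Notation mu := (@lebesgue_measure R).
Local Notation aff := (fun t : R => (k * t + c)%R).

Let phi (t : measurableTypeR R) : measurableTypeR R := k * t + c.

Lemma measurable_affine : measurable_fun [set: R] aff.
Proof. by apply: measurable_funD => //; exact: measurable_funM. Qed.

Let mphi : measurable_fun [set: measurableTypeR R] phi.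
Proof. exact: measurable_affine. Qed.

Let kn : {nonneg R} := NngNum (normr_ge0 k).

Let nu : {measure set (measurableTypeR R) -> \bar R} :=
  mscale kn
    (measure_function_pushforward__canonical__measure_function_Measure mu mphi).

(** [nu], the pushforward of [mu] by the affine map scaled by [|k|], agrees with [mu] on the
    intervals []x, y]], and these values determine Lebesgue measure. *)
Lemma affine_preimage_measure (A : set R) : measurable A ->
  mu A = (`|k|%:E * mu (aff @^-1` A))%E.
Proof.
move=> mA; suff: mu A = nu A by [].
apply: lebesgue_measure_unique mA => _ [[x y]] _ <-.
rewrite -[RHS]/(`|k|%:E * mu (phi @^-1` [set` `]x, y]]))%E.
have [kp|kn0] := ltP 0 k.
  have -> : phi @^-1` `]x, y] = `]((x - c) / k), ((y - c) / k)]%classic.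
    apply/seteqP; split => t /=; rewrite !in_itv/= ltr_pdivrMr// ler_pdivlMr//;
      by rewrite ltrBlDr lerBrDr mulrC.
  rewrite !lebesgue_measure_itv/= !lte_fin ltr_pM2r ?invr_gt0// ltrD2r.
  case: ifPn => _; last by rewrite mule0.
  rewrite -!EFinB -EFinM; congr EFin; rewrite gtr0_norm//; field.
  exact: lt0r_neq0.
(* A negative slope reverses the interval, so the closed end moves to the left; the length is
   unaffected. *)
have kneg : k < 0 by rewrite lt_neqAle k0.
have -> : phi @^-1` `]x, y] = `[((y - c) / k), ((x - c) / k)[%classic.
  apply/seteqP; split => t /=; rewrite !in_itv/= ler_ndivrMr// ltr_ndivlMr//;
    by rewrite ltrBlDr lerBrDr mulrC andbC.
rewrite !lebesgue_measure_itv/= !lte_fin ltr_nM2r ?invr_lt0// ltrD2r.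
case: ifPn => _; last by rewrite mule0.
rewrite -!EFinB -EFinM; congr EFin; rewrite ltr0_norm//; field.
by [].
Qed.

(** A null exceptional set has a null preimage: [|k|] times the measure of the preimage is 0, and
    [k] is nonzero. *)
Lemma ae_affine (P : R -> Prop) :
  (\forall t \ae mu, P t) -> \forall t \ae mu, P (k * t + c).
Proof.
move=> [N [mN N0 PN]].
exists (aff @^-1` N); split.
- by rewrite -[X in measurable X]setTI; exact: measurable_affine.
- have := affine_preimage_measure mN; rewrite N0 => /esym/eqP.
  by rewrite mule_eq0 eqe normr_eq0 (negPf k0) => /eqP.
- by move=> t /= Pt; apply: PN.
Qed.

(** Replacing [mu] by the equal measure [nu] turns the integral into a scaled integral against a
    pushforward. *)
Lemma ge0_integral_affine (D : set R) (f : R -> \bar R) : measurable D ->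
  measurable_fun D f -> (forall t, D t -> 0 <= f t)%E ->
  (\int[mu]_(t in D) f t =
   `|k|%:E * \int[mu]_(t in aff @^-1` D) f (k * t + c)%R)%E.
Proof.
move=> mD mf f0.
transitivity (\int[nu]_(t in D) f t)%E.
  by apply: eq_measure_integral => // A mA _; exact: affine_preimage_measure.
rewrite ge0_integral_mscale//; congr (_ * _)%E.
by rewrite ge0_integral_pushforward// => y; rewrite inE; exact: f0.
Qed.

Lemma measurable_fun_affine (D : set R) (f : R -> R) : measurable D ->
  measurable_fun D f ->
  measurable_fun (aff @^-1` D) (fun t => f (k * t + c)).
Proof.
move=> mD mf; apply: (measurable_comp mD) => //.
- by move=> _ [t Dt <-].
- exact: measurable_funTS measurable_affine.
Qed.

Lemma integrable_affine (D : set R) (f : R -> R) : measurable D ->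
  mu.-integrable D (EFin \o f) ->
  mu.-integrable (aff @^-1` D) (EFin \o (fun t => f (k * t + c))).
Proof.
move=> mD intf; have mf : measurable_fun D f.
  by apply/measurable_EFinP; exact: measurable_int intf.
apply/integrableP; split.
  by apply/measurable_EFinP; exact: measurable_fun_affine.
have /integrableP[_] := intf.
rewrite ge0_integral_affine//; last first.
  by apply/measurable_EFinP; exact: measurableT_comp.
(* An infinite integral after substitution would, multiplied by [|k| > 0], already be infinite
   before it. *)
move=> h; rewrite ltNge; apply/negP; rewrite leye_eq => /eqP e.
by move: h; rewrite e gt0_muley ?ltxx// lte_fin normr_gt0.
Qed.

Lemma Rintegral_affine (D : set R) (f : R -> R) : measurable D ->
  mu.-integrable D (EFin \o f) ->
  \int[mu]_(t in D) f t =
  `|k| * \int[mu]_(t in aff @^-1` D) f (k * t + c).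
Proof.
move=> mD intf; have intfk := integrable_affine mD intf.
have mD' : measurable (aff @^-1` D).
  by rewrite -[X in measurable X]setTI; exact: measurable_affine.
have mf := measurable_int _ intf.
rewrite /Rintegral -[X in X * _]/(fine `|k|%:E) -fineM//; last first.
  exact: integrable_fin_num intfk.
congr fine; rewrite integralE (ge0_integral_affine mD)//; last first.
  exact: measurable_funepos.
rewrite (ge0_integral_affine mD)//; last exact: measurable_funeneg.
(* Finiteness of the positive part excludes an indeterminate difference, so [|k|] can be distributed
   over the two parts. *)
have Ifin : (\int[mu]_(x in aff @^-1` D)
    ((EFin \o (fun t => f (k * t + c)%R))^\+ x) \is a fin_num)%E.
  by apply: integrable_fin_num => //; exact: integrable_funepos.
rewrite [in RHS]integralE [RHS]muleBr; first last.
- exact: fin_num_adde_defr.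
- by [].
by congr (_ * _ - _ * _)%E; apply: eq_integral => t _;
  rewrite ?funeposE ?funenegE.
Qed.

End AffineSubstitution.

(** * Integration of complex-valued functions *)

Section ComplexIntegral.
Variable R : realType.
Local Notation mu := (@lebesgue_measure R).
Implicit Types (D : set R) (f g h : R -> R[i]) (x y : R[i]).

Lemma complex_ReM x y : complex.Re (x * y) =
  complex.Re x * complex.Re y - complex.Im x * complex.Im y.
Proof. by case: x y => [? ?] [? ?]. Qed.

Lemma complex_ImM x y : complex.Im (x * y) =
  complex.Re x * complex.Im y + complex.Im x * complex.Re y.
Proof. by case: x y => [? ?] [? ?]. Qed.

Lemma complex_ReD x y : complex.Re (x + y) = complex.Re x + complex.Re y.
Proof. by case: x y => [? ?] [? ?]. Qed.

Lemma complex_ImD x y : complex.Im (x + y) = complex.Im x + complex.Im y.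
Proof. by case: x y => [? ?] [? ?]. Qed.

Definition cintegrable D f :=
  mu.-integrable D (fun t => (complex.Re (f t))%:E) /\
  mu.-integrable D (fun t => (complex.Im (f t))%:E).

(** A class of multipliers preserving integrability. Iterated integrals, as functions of their lower
    limit, belong to it. *)
Definition cbounded_measurable D g :=
  [/\ measurable_fun D (fun t => complex.Re (g t)),
      measurable_fun D (fun t => complex.Im (g t)) &
      exists M : R, forall t, D t ->
        `|complex.Re (g t)| <= M /\ `|complex.Im (g t)| <= M].

Lemma cintegrableS D E f : measurable D -> measurable E -> E `<=` D ->
  cintegrable D f -> cintegrable E f.
Proof.
by move=> mD mE ED [f1 f2]; split; [move: f1|move: f2]; exact: integrableS.
Qed.

Lemma cintegrable0 D : cintegrable D (fun=> 0).
Proof. by split; exact: integrable0. Qed.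

Lemma cintegrableD D f g : measurable D -> cintegrable D f ->
  cintegrable D g -> cintegrable D (fun t => f t + g t).
Proof.
move=> mD [f1 f2] [g1 g2]; split.
- by under eq_fun do rewrite complex_ReD EFinD; exact: integrableD.
- by under eq_fun do rewrite complex_ImD EFinD; exact: integrableD.
Qed.

Lemma cintegrable_mul D f g : measurable D -> cintegrable D f ->
  cbounded_measurable D g -> cintegrable D (fun t => g t * f t).
Proof.
move=> mD [f1 f2] [g1 g2 [M gM]].
have bd (h : R -> R) : (forall t, D t -> `|h t| <= M) ->
    [bounded h t : R | t in D].
  move=> hM; exists M; split; first exact: num_real.
  by move=> z Mz t /hM /le_trans; apply; exact: ltW.
have b1 : [bounded complex.Re (g t) | t in D] by apply: bd => t /gM[].
have b2 : [bounded complex.Im (g t) | t in D] by apply: bd => t /gM[].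
have mulI (h k : R -> R) : mu.-integrable D (fun t => (k t)%:E) ->
    measurable_fun D h -> [bounded h t : R | t in D] ->
    mu.-integrable D (fun t => (h t * k t)%:E).
  move=> ki mh bh; under eq_fun do rewrite EFinM.
  exact: (@integrableMr _ _ _ mu D _ h (fun t => (k t)%:E)).
split.
- under eq_fun do rewrite complex_ReM EFinB.
  by apply: integrableB => //; exact: mulI.
- under eq_fun do rewrite complex_ImM EFinD.
  by apply: integrableD => //; exact: mulI.
Qed.

Lemma cbounded_measurable_cst D x : cbounded_measurable D (fun=> x).
Proof.
split; [exact: measurable_cst|exact: measurable_cst|].
exists (`|complex.Re x| + `|complex.Im x|) => t _.
by rewrite lerDl lerDr !normr_ge0.
Qed.

Lemma cintegrableZ D f x : measurable D -> cintegrable D f ->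
  cintegrable D (fun t => x * f t).
Proof.
by move=> mD fi; apply: cintegrable_mul => //; exact: cbounded_measurable_cst.
Qed.

Lemma eq_cintegral D f g : {in D, f =1 g} -> cintegral D f = cintegral D g.
Proof.
by move=> fg; congr (_ +i* _); apply: eq_Rintegral => t Dt; rewrite fg.
Qed.

Lemma cintegral0 D : cintegral D (fun=> 0) = 0.
Proof.
by rewrite /cintegral /Rintegral /= integral0.
Qed.

Lemma cintegralD D f g : measurable D -> cintegrable D f ->
  cintegrable D g ->
  cintegral D (fun t => f t + g t) = cintegral D f + cintegral D g.
Proof.
move=> mD [f1 f2] [g1 g2]; rewrite /cintegral.
under eq_Rintegral do rewrite complex_ReD.
under [X in _ +i* X]eq_Rintegral do rewrite complex_ImD.
by rewrite !RintegralD.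
Qed.

Lemma cintegralZ D f x : measurable D -> cintegrable D f ->
  cintegral D (fun t => x * f t) = x * cintegral D f.
Proof.
move=> mD [f1 f2]; rewrite /cintegral.
under eq_Rintegral do rewrite complex_ReM.
under [X in _ +i* X]eq_Rintegral do rewrite complex_ImM.
have Zi (k : R) (h : R -> R) : mu.-integrable D (fun t => (h t)%:E) ->
    mu.-integrable D (EFin \o (fun t => k * h t)).
  move=> hi; rewrite /comp; under eq_fun do rewrite EFinM.
  exact: integrableZl.
rewrite RintegralB; [|by []|exact: Zi|exact: Zi].
rewrite RintegralD; [|by []|exact: Zi|exact: Zi].
by rewrite !RintegralZl//; case: x.
Qed.

Lemma cintegral_cat (u m v : R) f : u <= m -> m <= v ->
  cintegrable `]u, v] f ->
  cintegral `]u, v] f = cintegral `]u, m] f + cintegral `]m, v] f.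
Proof.
move=> um mv [f1 f2]; rewrite /cintegral.
rewrite -(Rintegral_itvB (f := fun t => complex.Re (f t)) (x := m) f1)//.
rewrite -(Rintegral_itvB (f := fun t => complex.Im (f t)) (x := m) f2)//.
by congr (_ +i* _); rewrite addrC subrK.
Qed.

Lemma cintegral_bnd (b0 b1 : bool) (u v : R) f : cintegrable `]u, v] f ->
  cintegral [set` Interval (BSide b0 u) (BSide b1 v)] f = cintegral `]u, v] f.
Proof.
have bnd (h : R -> R) : mu.-integrable `]u, v] (EFin \o h) ->
    \int[mu]_(t in [set` Interval (BSide b0 u) (BSide b1 v)]) h t =
    \int[mu]_(t in `]u, v]) h t.
  move=> /(measurable_int mu) mh; have mh' : measurable_fun `]u, v[ (EFin \o h).
    by apply: measurable_funS mh => //; exact: subset_itv_oo_oc.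
  by rewrite /Rintegral integral_itv_bndoo// [in RHS]integral_itv_bndoo.
by move=> [f1 f2]; congr (_ +i* _); exact: bnd.
Qed.

Lemma cintegral_affine (k c : R) D f : k != 0 -> measurable D ->
  cintegrable D f ->
  cintegral D f =
  (`|k|)%:C * cintegral ((fun t => k * t + c) @^-1` D) (fun t => f (k * t + c)).
Proof.
move=> k0 mD [f1 f2]; rewrite /cintegral.
rewrite (Rintegral_affine c k0 mD f1) (Rintegral_affine c k0 mD f2).
by apply/eqP; rewrite eq_complex /= !mul0r subr0 addr0 !eqxx.
Qed.

Lemma cintegrable_affine (k c : R) D f : k != 0 -> measurable D ->
  cintegrable D f ->
  cintegrable ((fun t => k * t + c) @^-1` D) (fun t => f (k * t + c)).
Proof.
move=> k0 mD [f1 f2]; split.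
- exact: (integrable_affine c k0 mD f1).
- exact: (integrable_affine c k0 mD f2).
Qed.

(** On each component the tail integral is [F T - F s] for a primitive [F] continuous on the compact
    [[0, T]], hence measurable and bounded. This is what allows integrals to be nested. *)
Lemma cintegral_cbounded_measurable (T : R) f : cintegrable `]0, T] f ->
  cbounded_measurable `]0, T] (fun s => cintegral `[s, T] f).
Proof.
have [T0|T0 _] := leP 0 T; last first.
  have -> : `]0, T]%classic = set0 :> set R.
    by rewrite set_itv_ge// bnd_simp -leNgt ltW.
  split; [exact: measurable_fun_set0|exact: measurable_fun_set0|].
  by exists 0.
have tail (h : R -> R) : mu.-integrable `]0, T] (EFin \o h) ->
    measurable_fun `]0, T] (fun s => \int[mu]_(t in `[s, T]) h t) /\
    exists M, forall s, `]0, T]%classic s ->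
      `|\int[mu]_(t in `[s, T]) h t| <= M.
  move=> hi; have hi0 : mu.-integrable `[0, T] (EFin \o h).
    have mh : measurable_fun `]0, T] h.
      by apply/measurable_EFinP; exact: measurable_int hi.
    apply/integrableP; split.
      by apply/measurable_EFinP; exact: measurable_fun_itv_cc mh.
    rewrite -integral_itv_obnd_cbnd; first by case/integrableP: hi.
    by apply: measurableT_comp => //; exact/measurable_EFinP.
  pose F := parameterized_integral mu 0 ^~ h.
  have cF : {within `[0, T], continuous F}.
    exact: parameterized_integral_continuous.
  have hE s : `]0, T]%classic s ->
      \int[mu]_(t in `[s, T]) h t = F T - F s.
    rewrite /= in_itv/= => /andP[s0 sT].
    have hs : mu.-integrable `]s, T] (EFin \o h).
      by apply: integrableS hi => //; apply: subset_itvr; rewrite bnd_simp ltW.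
    rewrite -(Rintegral_itv_obnd_cbnd hs).
    by rewrite -(Rintegral_itvB hi0)// bnd_simp// ltW.
  split.
    apply: (eq_measurable_fun (fun s => F T - F s)).
      by move=> s; rewrite inE => /hE.
    apply: measurable_funB => //.
    apply: measurable_fun_itv_oc.
    by apply: subspace_continuous_measurable_fun cF.
  (* Boundedness is provided for constants strictly above [M], whence the [M + 1] below. *)
  have [M [_ FM]] :=
    compact_bounded (continuous_compact cF (@segment_compact _ 0 T)).
  exists (`|F T| + (M + 1)) => s Ds; rewrite hE//.
  rewrite (le_trans (ler_normB _ _))// lerD2l; apply: FM; first by rewrite ltrDl.
  by exists s => //; exact: subset_itv_oc_cc Ds.
move=> [/tail[m1 [M1 b1]] /tail[m2 [M2 b2]]]; split => //.
exists (Num.max M1 M2) => s Ds; rewrite !le_max b1// b2//; split => //.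
by rewrite orbT.
Qed.

End ComplexIntegral.

(** * The space X *)

Section Paths.
Variable R : realType.
Local Notation mu := (@lebesgue_measure R).
Implicit Types (a b : nat -> R -> R[i]) (f : R -> R[i]) (t : R).

Lemma two_pi_gt0 : 0 < 2 * pi :> R.
Proof. by rewrite mulr_gt0// pi_gt0. Qed.

Lemma circle_repr_id t : 0 < t -> t <= 2 * pi -> circle_repr t = t.
Proof.
move=> t0 t2; rewrite /circle_repr (_ : Num.ceil _ = 1).
  by rewrite subrr mulr0 subr0.
apply: ceil_def; rewrite subrr divr_gt0 ?two_pi_gt0//=.
by rewrite ler_pdivrMr ?two_pi_gt0// mul1r.
Qed.

Lemma circle_repr_periodic t : circle_repr (t + 2 * pi) = circle_repr t.
Proof.
have p0 : 2 * pi != 0 :> R by rewrite gt_eqF// two_pi_gt0.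
have e : (t + 2 * pi) / (2 * pi) = t / (2 * pi) + 1.
  by rewrite mulrDl mulfV.
by rewrite /circle_repr e ceilDrz// ceil1 addrK intrB /=; ring.
Qed.

Lemma measurable_circle_repr : measurable_fun [set: R] (@circle_repr R).
Proof.
apply: measurable_funB => //; apply: measurable_funM => //.
apply: nondecreasing_measurable => // x y xy.
by rewrite ler_int lerD2r; apply: le_ceil; rewrite ler_pM2r// invr_gt0 two_pi_gt0.
Qed.

Lemma periodic_int f (m : int) t : (forall t, f (t + 2 * pi) = f t) ->
  f (t + 2 * pi * m%:~R) = f t.
Proof.
move=> fp; have fpn (n : nat) u : f (u + 2 * pi * n%:R) = f u.
  elim: n => [|n IH]; first by rewrite mulr0 addr0.
  by rewrite -[n.+1%:R]natr1 mulrDr mulr1 addrA fp.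
case: m => n; first exact: fpn.
by rewrite NegzE mulrNz -(fpn n.+1 (_ + _)) mulrN subrK.
Qed.

Lemma normc_realM (x : R) (z : R[i]) : 0 <= x ->
  Normc.normc (x%:C * z) = x * Normc.normc z.
Proof.
by move=> x0; rewrite Normc.normcM /= expr0n/= addr0 sqrtr_sqr ger0_norm.
Qed.

(* By periodicity both halves are dilations; [+ 0] puts them in the affine form
   of [measurable_affine] and [ae_affine]. *)
Lemma concatE a b n t : (forall t, a n (t + 2 * pi) = a n t) ->
  (forall t, b n (t + 2 * pi) = b n t) ->
  concat a b n t =
  if circle_repr t <= pi then 2%:C * a n (2 * t + 0) else 2%:C * b n (2 * t + 0).
Proof.
move=> ap bp; rewrite /concat /periodize (rmorph_nat (@real_complex R) 2).
rewrite /circle_repr; move: (Num.ceil _ - 1) => k.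
case: ifP => _; congr (2 * _).
- rewrite -(periodic_int (k *+ 2) _ ap).
  by congr (a n _); rewrite rmorphMn /=; ring.
- rewrite -(periodic_int (k *+ 2 + 1) _ bp).
  by congr (b n _); rewrite rmorphD rmorphMn /=; ring.
Qed.

(** Periodicity absorbs the multiple of [2 * pi] hidden in [circle_repr], leaving one affine formula
    on the whole line. *)
Lemma path_invE a n t : (forall t, a n (t + 2 * pi) = a n t) ->
  path_inv a n t = - a n (-1 * t + 2 * pi).
Proof.
move=> ap; rewrite /path_inv /periodize; congr (- _).
rewrite /circle_repr -[RHS](periodic_int (Num.ceil (t / (2 * pi)) - 1))//.
by congr (a n _); ring.
Qed.

(** An exact equality of functions, by periodicity; it later turns left inverses of series into
    right inverses. *)
Lemma path_invK a : X R a -> path_inv (path_inv a) = a.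
Proof.
move=> [ap _]; apply/funext => n; apply/funext => t.
have apn := (ap n).2.
have p' u : path_inv a n (u + 2 * pi) = path_inv a n u.
  by rewrite /path_inv /periodize circle_repr_periodic.
by rewrite path_invE// path_invE// opprK; congr (a n _); ring.
Qed.

Lemma ae_mono (P Q : R -> Prop) : (forall t, P t -> Q t) ->
  (\forall t \ae mu, P t) -> \forall t \ae mu, Q t.
Proof.
by move=> PQ; exact: (@filterS _ _ (ae_filter_ringOfSetsType mu) _ _ PQ).
Qed.

Lemma ae_mono2 (P Q S : R -> Prop) : (forall t, P t -> Q t -> S t) ->
  (\forall t \ae mu, P t) -> (\forall t \ae mu, Q t) -> \forall t \ae mu, S t.
Proof.
by move=> PQ; exact: (@filterS2 _ _ (ae_filter_ringOfSetsType mu) _ _ _ PQ).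
Qed.
(** The pointwise almost-everywhere form of the bound can be transported by affine maps through
    [ae_affine]. *)
Lemma XP a : X R a <->
  (forall n, cmeasurable (a n) /\ forall t, a n (t + 2 * pi) = a n t) /\
  exists l : R, 0 < l /\ forall n : nat,
    \forall t \ae mu, Normc.normc (a n t) <= l ^+ n.+1.
Proof.
split=> -[ap [l [l0 al]]]; split => //; exists l; split => // n.
- by have /ess_supP := al n; apply: ae_mono => t; rewrite lee_fin.
- by apply/ess_supP; have := al n; apply: ae_mono => t; rewrite lee_fin.
Qed.

Lemma X_zero : X R (zero_path R).
Proof.
apply/XP; split; first by move=> n; split => //; split; exact: measurable_cst.
exists 1; split => // n; apply: aeW => t.
by rewrite /zero_path Normc.normc0 expr1n.
Qed.

Lemma X_path_inv a : X R a -> X R (path_inv a).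
Proof.
move=> /XP[ap [l [l0 al]]].
have aE n : path_inv a n = fun t => - a n (-1 * t + 2 * pi).
  by apply/funext => t; exact: path_invE (ap n).2.
apply/XP; split.
  move=> n; split; last first.
    by move=> t; rewrite /path_inv /periodize circle_repr_periodic.
  have [[m1 m2] _] := ap n; rewrite aE; split.
  - under eq_fun do rewrite raddfN; apply: measurable_funN.
    exact: (measurableT_comp m1 (measurable_affine _ _)).
  - under eq_fun do rewrite raddfN; apply: measurable_funN.
    exact: (measurableT_comp m2 (measurable_affine _ _)).
exists l; split => // n; rewrite aE.
have n10 : -1 != 0 :> R by rewrite oppr_eq0 oner_eq0.
have := ae_affine (2 * pi) n10 (al n); apply: ae_mono => t.
by rewrite normcN.
Qed.

Lemma X_concat a b : X R a -> X R b -> X R (concat a b).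
Proof.
move=> /XP[ap [l [l0 al]]] /XP[bp [m [m0 bm]]].
have E n : concat a b n = fun t => if circle_repr t <= pi
    then 2%:C * a n (2 * t + 0) else 2%:C * b n (2 * t + 0).
  by apply/funext => t; exact: concatE (ap n).2 (bp n).2.
have two0 : 2 != 0 :> R by [].
apply/XP; split.
  move=> n; split; last first.
    by move=> t; rewrite /concat /periodize circle_repr_periodic.
  have mle : measurable_fun [set: R] (fun t => circle_repr t <= pi).
    by apply: measurable_fun_ler => //; exact: measurable_circle_repr.
  have [[a1 a2] _] := ap n; have [[b1 b2] _] := bp n.
  have mul2 (h : R -> R) : measurable_fun [set: R] h ->
      measurable_fun [set: R] (fun t => 2 * h (2 * t + 0)).
    move=> mh; apply: measurable_funM => //.
    exact: (measurableT_comp mh (measurable_affine _ _)).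
  rewrite E; split.
  - rewrite (_ : (fun _ => _) = fun t => if circle_repr t <= pi
        then 2 * complex.Re (a n (2 * t + 0))
        else 2 * complex.Re (b n (2 * t + 0))); last first.
      by apply/funext => t; case: ifP; rewrite complex_ReM /= mul0r subr0.
    by apply: measurable_fun_ifT => //; [exact: mul2 _ a1|exact: mul2 _ b1].
  - rewrite (_ : (fun _ => _) = fun t => if circle_repr t <= pi
        then 2 * complex.Im (a n (2 * t + 0))
        else 2 * complex.Im (b n (2 * t + 0))); last first.
      by apply/funext => t; case: ifP; rewrite complex_ImM /= mul0r addr0.
    by apply: measurable_fun_ifT => //; [exact: mul2 _ a2|exact: mul2 _ b2].
(* Doubling the speed costs a factor 2, absorbed in the geometric rate because [2 <= 2 ^+ n.+1]. *)
exists (2 * Num.max l m); split; first by rewrite mulr_gt0// lt_max l0.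
move=> n; rewrite E.
have bd (x : R) (z : R[i]) : 0 < x -> x <= Num.max l m ->
    Normc.normc z <= x ^+ n.+1 ->
    Normc.normc (2%:C * z) <= (2 * Num.max l m) ^+ n.+1.
  move=> x0 xM zx; rewrite normc_realM// exprMn ler_pM//.
  - by case: z zx => u v _; exact: sqrtr_ge0.
  - by rewrite exprS ler_peMr// exprn_ege1// ler1n.
  - by rewrite (le_trans zx)// lerXn2r// nnegrE ?ltW// (lt_le_trans x0).
have := ae_affine 0 two0 (bm n); have := ae_affine 0 two0 (al n).
apply: ae_mono2 => t ha hb.
case: ifPn => _; [apply: (bd l)|apply: (bd m)] => //; by rewrite le_max lexx ?orbT.
Qed.

(** An essentially bounded measurable function is integrable on an interval of finite measure. *)
Lemma cintegrable_X a n (u v : R) : X R a -> cintegrable `]u, v] (a n).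
Proof.
move=> /XP[ap [l [l0 al]]]; have [[m1 m2] _] := ap n.
have key (h : R -> R) : measurable_fun [set: R] h ->
    (forall t, `|h t| <= Normc.normc (a n t)) ->
    mu.-integrable `]u, v] (fun t => (h t)%:E).
  move=> mh hb; apply/integrableP; split.
    by apply/measurable_EFinP; exact: measurable_funTS.
  apply: le_lt_trans (_ : ((l ^+ n.+1)%:E * mu `]u, v] < +oo)%E).
    apply: integral_le_bound => //.
    - by apply/measurable_EFinP; exact: measurable_funTS.
    - by rewrite lee_fin exprn_ge0// ltW.
    - by have := al n; apply: ae_mono => t /(le_trans (hb t)) ? _; rewrite lee_fin.
  rewrite lebesgue_measure_itv/=; case: ifP => _; last by rewrite mule0.
  by rewrite -EFinB -EFinM ltry.
split; apply: key => // t; case: (a n t) => x y /=.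
- by rewrite -sqrtr_sqr ler_wsqrtr// lerDl sqr_ge0.
- by rewrite -sqrtr_sqr ler_wsqrtr// lerDr sqr_ge0.
Qed.

End Paths.

(** * Convolution of functions on words *)

Section WordConvolution.
Variables (T : eqType) (C : comPzRingType).
Implicit Types (u v z : seq T -> C) (w : seq T).

(** The coefficient at [w] of the product of two noncommutative power series: the sum of [u x * v y]
    over all splittings [w = x ++ y]. The recursion passes the first letter to [u]. *)
Fixpoint conv u v w : C :=
  u [::] * v w + (if w is i :: w' then conv (fun x => u (i :: x)) v w' else 0).

Definition conv_unit w : C := (w == [::])%:R.

Lemma eq_convl u u' v w : u =1 u' -> conv u v w = conv u' v w.
Proof. by move=> uu'; rewrite (_ : u = u')//; exact/funext. Qed.

Lemma convDl u u' v w :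
  conv (fun x => u x + u' x) v w = conv u v w + conv u' v w.
Proof.
elim: w u u' => [|i w IH] u u' /=; first by rewrite !addr0 mulrDl.
by rewrite IH mulrDl addrACA.
Qed.

Lemma convZl k u v w : conv (fun x => k * u x) v w = k * conv u v w.
Proof.
elim: w u => [|i w IH] u /=; first by rewrite !addr0 mulrA.
by rewrite IH mulrDr mulrA.
Qed.

(** Peeling off a letter of [w] makes the left factor [conv u v] a multiple of a shift of [v] plus a
    convolution with a shift of [u]; linearity and induction over all [u], [v] conclude. *)
Lemma convA u v z w : conv (conv u v) z w = conv u (conv v z) w.
Proof.
elim: w u v => [|i w IH] u v /=; first by rewrite !addr0 mulrA.
by rewrite addr0 convDl convZl IH mulrDr mulrA addrA.
Qed.

Lemma conv_unitl v w : conv conv_unit v w = v w.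
Proof.
have conv0 w' : conv (fun=> 0) v w' = 0.
  by elim: w' => [|i w' IH] /=; rewrite ?IH mul0r addr0.
by case: w => [|i w] /=; rewrite /conv_unit /= mul1r ?conv0 addr0.
Qed.

Lemma conv_unitr u w : conv u conv_unit w = u w.
Proof.
elim: w u => [|i w IH] u /=; first by rewrite /conv_unit /= mulr1 addr0.
by rewrite IH /conv_unit /= mulr0 add0r.
Qed.

End WordConvolution.

(** * Iterated integrals *)

Section IteratedIntegrals.
Variable R : realType.
Implicit Types (a b : nat -> R -> R[i]) (s t : R).

Lemma conv_cintegrable (T : eqType) (D : set R) (F : R -> seq T -> R[i]) v :
  measurable D -> (forall w, cintegrable D (F ^~ w)) ->
  forall w, cintegrable D (fun t => conv (F t) v w).
Proof.
move=> mD Fi w; elim: w F Fi => [|i w IH] F Fi /=.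
  apply: cintegrableD => //; last exact: cintegrable0.
  by under eq_fun do rewrite mulrC; exact: cintegrableZ.
apply: cintegrableD => //.
  by under eq_fun do rewrite mulrC; exact: cintegrableZ.
by apply: (IH (fun t x => F t (i :: x))) => x; exact: Fi.
Qed.

(** At a fixed word, [conv] is a finite linear combination of values of [F t] with coefficients
    independent of [t]. *)
Lemma cintegral_conv (T : eqType) (D : set R) (F : R -> seq T -> R[i]) v :
  measurable D -> (forall w, cintegrable D (F ^~ w)) -> forall w,
  cintegral D (fun t => conv (F t) v w) =
  conv (fun x => cintegral D (F ^~ x)) v w.
Proof.
move=> mD Fi w.
have FZ (G : R -> R[i]) x : cintegrable D G -> cintegrable D (fun t => G t * x).
  by move=> Gi; under eq_fun do rewrite mulrC; exact: cintegrableZ.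
have intFZ (G : R -> R[i]) x : cintegrable D G ->
    cintegral D (fun t => G t * x) = cintegral D G * x.
  by move=> Gi; under eq_fun do rewrite mulrC; rewrite cintegralZ// mulrC.
elim: w F Fi => [|i w IH] F Fi /=.
  by rewrite cintegralD ?cintegral0 ?intFZ//; [exact: FZ|exact: cintegrable0].
rewrite cintegralD ?intFZ//; last 2 first.
- exact: FZ.
- by apply: (conv_cintegrable (F := fun t x => F t (i :: x))) => // x; exact: Fi.
by congr (_ + _); apply: (IH (fun t x => F t (i :: x))) => x; exact: Fi.
Qed.

(** By induction on the word, the inner iterated integral is a bounded measurable function of its
    lower limit, multiplying an integrable component. *)
Lemma iter_int_integrable a i w : X R a ->
  cintegrable `]0, 2 * pi] (fun t => iter_int a t w * a i t).
Proof.
move=> Xa; elim: w i => [|j w IH] i;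
  apply: cintegrable_mul => //; try exact: cintegrable_X.
- exact: cbounded_measurable_cst.
- exact: cintegral_cbounded_measurable (IH j).
Qed.

Lemma iter_int_integrableS a i w s t : X R a -> 0 <= s -> t <= 2 * pi ->
  cintegrable `]s, t] (fun t => iter_int a t w * a i t).
Proof.
move=> Xa s0 tp; apply: cintegrableS (iter_int_integrable i w Xa) => //.
by apply: subset_itv; rewrite bnd_simp.
Qed.

(* The half-open interval avoids the junction 0, which [circle_repr] sends to
   the end of the path. *)
Lemma iter_int_cons a i w s : X R a -> 0 <= s ->
  iter_int a s (i :: w) =
  cintegral `]s, 2 * pi] (fun t => iter_int a t w * a i t).
Proof. by move=> Xa s0 /=; rewrite cintegral_bnd//; exact: iter_int_integrableS. Qed.

Lemma iter_int_2pi a w : iter_int a (2 * pi) w = conv_unit _ w.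
Proof.
case: w => [|i w] //=; rewrite set_itv1 /cintegral !Rintegral_set1.
by rewrite /conv_unit.
Qed.

Lemma itv_affine_preimage (k c x y : R) : 0 < k ->
  (fun t => k * t + c) @^-1` `]k * x + c, k * y + c] = `]x, y]%classic.
Proof.
by move=> k0; apply/seteqP; split => t /=;
  rewrite !in_itv/= ltrD2r lerD2r ltr_pM2l// ler_pM2l.
Qed.

Lemma cintegral_dilation (c x y : R) (f : R -> R[i]) :
  cintegrable `]2 * x + c, 2 * y + c] f ->
  cintegrable `]x, y] (fun t => f (2 * t + c)) /\
  cintegral `]2 * x + c, 2 * y + c] f =
    2%:C * cintegral `]x, y] (fun t => f (2 * t + c)).
Proof.
move=> fi; split.
- by rewrite -(itv_affine_preimage c x y (ltr0n _ 2)); exact: cintegrable_affine.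
- by rewrite (cintegral_affine (k := 2) c _ _ fi)// itv_affine_preimage// ger0_norm.
Qed.

Lemma concat_le_pi a b n t : 0 < t -> t <= pi ->
  concat a b n t = 2%:C * a n (2 * t).
Proof.
move=> t0 tp; rewrite /concat /periodize circle_repr_id//.
  by rewrite tp (rmorph_nat (@real_complex R) 2).
by rewrite (le_trans tp)// ler_peMl ?ler1n// pi_ge0.
Qed.

Lemma concat_gt_pi a b n t : pi < t -> t <= 2 * pi ->
  concat a b n t = 2%:C * b n (2 * t - 2 * pi).
Proof.
move=> tp t2; rewrite /concat /periodize circle_repr_id//.
  by rewrite leNgt tp (rmorph_nat (@real_complex R) 2).
by rewrite (lt_trans _ tp)// pi_gt0.
Qed.

(** Past [pi] only [b] is traversed, at double speed; the factor 2 in [concat] is the Jacobian of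
    the substitution. *)
Lemma iter_int_concat_ge_pi a b w s : X R a -> X R b ->
  pi <= s -> s <= 2 * pi ->
  iter_int (concat a b) s w = iter_int b (2 * s - 2 * pi) w.
Proof.
move=> Xa Xb; elim: w s => [//|i w IH] s ps s2.
have p0 : 0 <= pi :> R := pi_ge0 R.
have s0 : 0 <= 2 * s - 2 * pi by lra.
have Xab := X_concat Xa Xb.
rewrite !iter_int_cons//; last lra.
have fi : cintegrable `]2 * s - 2 * pi, 2 * (2 * pi) - 2 * pi]
    (fun t => iter_int b t w * b i t).
  by apply: iter_int_integrableS => //; lra.
have e : 2 * (2 * pi) - 2 * pi = 2 * pi :> R by ring.
have := cintegral_dilation fi; rewrite e => -[gi gE].
rewrite gE -cintegralZ//; apply: eq_cintegral => t.
rewrite inE/= in_itv/= => /andP[st t2].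
rewrite IH ?concat_gt_pi//; [by rewrite mulrCA|lra|lra].
Qed.

(** Chen's identity from a parameter in the first half. Splitting the outer integral at [pi] mirrors
    the recursion of [conv]: if [s_1] lies beyond [pi], the whole word goes to [b]; otherwise its
    first letter goes to [a]. *)
Lemma iter_int_concat_le_pi a b w s : X R a -> X R b ->
  0 <= s -> s <= pi ->
  iter_int (concat a b) s w = conv (iter_int a (2 * s)) (iter_int b 0) w.
Proof.
move=> Xa Xb; elim: w s => [|i w IH] s s0 sp; first by rewrite /= mulr1 addr0.
have p0 : 0 <= pi :> R := pi_ge0 R.
have Xab := X_concat Xa Xb.
have p2 : pi <= 2 * pi :> R by lra.
rewrite [RHS]/= mul1r -/(iter_int b 0 (i :: w)) iter_int_cons//.
rewrite (cintegral_cat sp p2); last exact: iter_int_integrableS.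
rewrite -(iter_int_cons i w Xab p0) (iter_int_concat_ge_pi _ Xa Xb)// subrr.
rewrite addrC; congr (_ + _).
have fi x : cintegrable `]2 * s + 0, 2 * pi + 0]
    (fun t => iter_int a t x * a i t).
  by apply: iter_int_integrableS => //; lra.
transitivity (2%:C * cintegral `]s, pi] (fun t =>
    conv (fun x => iter_int a (2 * t + 0) x * a i (2 * t + 0)) (iter_int b 0) w)).
  rewrite -cintegralZ//; last first.
    by apply: conv_cintegrable => // x; exact: (cintegral_dilation (fi x)).1.
  apply: eq_cintegral => t; rewrite inE/= in_itv/= => /andP[st tp].
  have t0 : 0 < t by lra.
  rewrite IH ?concat_le_pi//; [|exact: ltW].
  rewrite addr0 mulrCA; congr (_ * _).
  by rewrite mulrC -convZl; apply: eq_convl => x; rewrite mulrC.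
(* The integral moves onto the left factor of the convolution, where it rebuilds the iterated
   integral of [a] at [i :: x]. *)
rewrite cintegral_conv//; last by move=> x; exact: (cintegral_dilation (fi x)).1.
rewrite -convZl; apply: eq_convl => x.
rewrite -(cintegral_dilation (fi x)).2 !addr0.
by rewrite -[RHS]/(iter_int a (2 * s) (i :: x)) iter_int_cons// mulr_ge0.
Qed.

Lemma basic_iter_int_concat a b : X R a -> X R b ->
  basic_iter_int (concat a b) = conv (basic_iter_int a) (basic_iter_int b).
Proof.
move=> Xa Xb; apply/funext => w; rewrite /basic_iter_int.
by rewrite iter_int_concat_le_pi// ?pi_ge0// mulr0.
Qed.

(** From [2 * pi - s] on, the inverse path runs [a] back from [s] to 0; following it by all of [a]
    cancels the backtracking and leaves [a] from [s] on. At [s = 2 * pi] this gives the inverse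
    series. *)
Lemma iter_int_path_inv a w s : X R a -> 0 <= s -> s <= 2 * pi ->
  conv (iter_int (path_inv a) (2 * pi - s)) (iter_int a 0) w = iter_int a s w.
Proof.
move=> Xa; elim: w s => [|i w IH] s s0 s2; first by rewrite /= mulr1 addr0.
have p0 : 0 <= pi :> R := pi_ge0 R.
have Xi := X_path_inv Xa.
have hi := iter_int_integrableS i w Xa (lexx 0) (lexx (2 * pi)).
rewrite [LHS]/= mul1r -/(iter_int a 0 (i :: w)) !iter_int_cons//.
(* It remains to show that the convolution term is minus the integral over []0, s]]. *)
rewrite (cintegral_cat s0 s2 hi) addrC.
have N10 : -1 != 0 :> R by rewrite oppr_eq0 oner_eq0.
pose g x t := iter_int (path_inv a) t x * path_inv a i t.
have gi x : cintegrable `]2 * pi - s, 2 * pi] (g x).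
  by apply: iter_int_integrableS => //; lra.
have preE : (fun t => -1 * t + 2 * pi) @^-1` `]2 * pi - s, 2 * pi] =
    `[0, s[%classic.
  by apply/seteqP; split => t /=; rewrite !in_itv/= => /andP[? ?];
    apply/andP; split; lra.
have gi' x : cintegrable `[0, s[ (fun t => g x (-1 * t + 2 * pi)).
  by rewrite -preE; exact: cintegrable_affine (gi x).
have -> : conv (fun x => iter_int (path_inv a) (2 * pi - s) (i :: x))
      (iter_int a 0) w =
    conv (fun x => cintegral `[0, s[ (fun t => g x (-1 * t + 2 * pi)))
      (iter_int a 0) w.
  apply: eq_convl => x; rewrite iter_int_cons//; last lra.
  rewrite (cintegral_affine (2 * pi) N10 _ (gi x))// preE.
  by rewrite normrN normr1 mul1r.
rewrite -(cintegral_conv (F := fun t x => g x (-1 * t + 2 * pi)))//.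
have hs : cintegrable `]0, s] (fun t => iter_int a t w * a i t).
  exact: iter_int_integrableS.
have -> : cintegral `[0, s[ (fun t => conv (fun x => g x (-1 * t + 2 * pi))
      (iter_int a 0) w) =
    - cintegral `]0, s] (fun t => iter_int a t w * a i t).
  rewrite -(cintegral_bnd true true hs); apply: oppr_inj.
  rewrite opprK -[LHS]mulN1r -cintegralZ//; last first.
    exact: (conv_cintegrable (F := fun t x => g x (-1 * t + 2 * pi))).
  apply: eq_cintegral => t; rewrite inE/= in_itv/= => /andP[t0 ts].
  (* The induction hypothesis at parameter [t] identifies the integrand; the minus sign comes from
     [path_inv]. *)
  rewrite -IH//; last lra.
  rewrite [RHS]mulrC -!convZl; apply: eq_convl => x.
  rewrite /g path_invE; last exact: (Xa.1 i).2.
  have -> : -1 * (-1 * t + 2 * pi) + 2 * pi = t by ring.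
  have -> : -1 * t + 2 * pi = 2 * pi - t by ring.
  by rewrite mulrN mulN1r opprK mulrC.
by rewrite addKr.
Qed.

Lemma basic_iter_int_path_inv a : X R a ->
  conv (basic_iter_int (path_inv a)) (basic_iter_int a) = conv_unit _.
Proof.
move=> Xa; apply/funext => w; rewrite -(iter_int_2pi a).
rewrite -(iter_int_path_inv w Xa (ltW (two_pi_gt0 R)) (lexx _)).
by rewrite subrr.
Qed.

(** With S the series of iterated integrals, S(a) S(b^-1) = 1 is multiplied on the right by S(b),
    using S(b^-1) S(b) = 1. *)
Lemma path_equivP a b : X R a -> X R b ->
  path_equiv a b <-> basic_iter_int a = basic_iter_int b.
Proof.
move=> Xa Xb; have Xib := X_path_inv Xb; split.
- move=> [_ abU]; apply/funext => w.
  rewrite -[LHS]conv_unitr -(basic_iter_int_path_inv Xb) -convA.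
  rewrite -basic_iter_int_concat// -[RHS]conv_unitl.
  (* Universal centers constrain nonempty words only; on the empty word both sides are 1. *)
  apply: eq_convl => {}w; have [->|w0] := eqVneq w [::]; first by [].
  by rewrite abU// /conv_unit (negPf w0).
- move=> ab; split=> [|w w0]; first exact: X_concat.
  (* Reading [b] as the inverse of [path_inv b] makes the left inverse identity applicable. *)
  rewrite basic_iter_int_concat// ab -{1}(path_invK Xb).
  by rewrite basic_iter_int_path_inv// /conv_unit (negPf w0).
Qed.

Lemma basic_iter_int_zero : basic_iter_int (zero_path R) = conv_unit _.
Proof.
apply/funext => -[|i w] //; rewrite /basic_iter_int /=.
by under eq_cintegral do rewrite mulr0; rewrite cintegral0 /conv_unit.
Qed.

End IteratedIntegrals.

Theorem proposition3p2 (R : realType) (a a' b b' c : nat -> R -> complex R)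
    (Xa : X R a) (Xa' : X R a') (Xb : X R b) (Xb' : X R b') (Xc : X R c) :
  (path_equiv a a' -> path_equiv b b' ->
     path_equiv (concat a b) (concat a' b')) /\
  path_equiv (concat (concat a b) c) (concat a (concat b c)) /\
  path_equiv (concat a (zero_path R)) (concat (zero_path R) a) /\
  (path_equiv (concat a (path_inv a)) (zero_path R) /\
   path_equiv (zero_path R) (concat (path_inv a) a)).
Proof.
have X0 := X_zero R; have Xia := X_path_inv Xa.
split.
  move=> /(path_equivP Xa Xa') aa' /(path_equivP Xb Xb') bb'.
  apply/path_equivP; [exact: X_concat|exact: X_concat|].
  by rewrite !basic_iter_int_concat// aa' bb'.
split.
  have Xab := X_concat Xa Xb; have Xbc := X_concat Xb Xc.
  apply/path_equivP; [exact: X_concat|exact: X_concat|].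
  by rewrite !basic_iter_int_concat//; apply/funext => w; exact: convA.
split.
  apply/path_equivP; [exact: X_concat|exact: X_concat|].
  rewrite !basic_iter_int_concat// basic_iter_int_zero; apply/funext => w.
  by rewrite conv_unitl conv_unitr.
split; apply/path_equivP => //; try exact: X_concat.
(* The right inverse of [a] is the left inverse identity for [path_inv a]. *)
- rewrite basic_iter_int_concat// -{1}(path_invK Xa).
  by rewrite basic_iter_int_path_inv// basic_iter_int_zero.
- by rewrite basic_iter_int_concat// basic_iter_int_path_inv// basic_iter_int_zero.
Qed.
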